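(* For every accuracy $\delta$ with $0<\delta\le\frac{1}{35}$, the algorithm Planned-Harmonic (PH) is $\frac{3}{2}$-competitive for Online Bin Packing with Estimated Item Sizes, i.e., there is a constant $K$ such that $\mathrm{PH}(L)\le\frac{3}{2}\,OPT(L)+K$ for every input list $L$.
   Context: Online Bin Packing with Estimated Item Sizes: an input is a list $L$ of items. Before any item is revealed, the algorithm receives the accuracy $\delta\in(0,1]$ and an estimated size $c'(a)\in(0,1]$ for every $a\in L$. Items are then revealed one by one with actual sizes $c(a)\in[c'(a)(1-\delta),\min(c'(a)(1+\delta),1)]$ and each must be irrevocably assigned to a bin of capacity $1$ before the next is revealed; the goal is to minimize the number of bins. $A(L)$ is the number of bins used by $A$, $OPT(L)$ the optimal number of bins. $A$ is $c$-competitive if $A(L)\le c\cdot OPT(L)+K$ for a constant $K$ and all $L$. Harmonic$_4$: an item of actual size in $(\frac{1}{k+1},\frac1k]$ is of class $I_k$ for $k=1,2,3$, and of class $I_4$ if its size is in $(0,\frac14]$; items of each class are packed separately, only into bins containing items of that class: an $I_k$-item ($k\le3$) goes into the current open $I_k$-bin if it contains fewer than $k$ items, otherwise a new $I_k$-bin is opened; $I_4$-items are packed by Next Fit among $I_4$-bins (into the current open $I_4$-bin if it fits, otherwise into a new one). Planned-Harmonic (PH). Planning phase (before any item is revealed): let $I_{1g}=\{a\in L: (1-\delta)c'(a)>\frac12\}$, $I_{1p}=\{a\in L:(1+\delta)c'(a)>\frac12\}\setminus I_{1g}$, $I_{4+}=\{a\in L:(1-\delta)c'(a)\le\frac14\}$.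 For each $a\in I_{1g}$: let $S$ be a maximal (by greedily adding items) subset of the remaining $I_{4+}$ with $(1+\delta)(c'(a)+\sum_{a'\in S}c'(a'))\le1$, remove $S$ from $I_{4+}$, and plan to pack $a$ together with $S$ in one bin. Then for $i=1,\dots,|I_{1p}|$, stopping as soon as $I_{4+}$ is empty: let $S_i$ be a maximal subset of the remaining $I_{4+}$ with $(1+\delta)(\frac{1}{2(1-\delta)}+\sum_{a'\in S_i}c'(a'))\le1$, and designate a reserved bin $B_i$ for the items of $S_i$. Let $k$ be the number of reserved bins $B_i$ created. Update phase (when item $a$ is revealed; $l$ denotes the number of reserved bins $B_1,\dots,B_l$ that already contain an $I_{1p}$-item): if $a\in I_{1p}$ and $c(a)>\frac12$, pack $a$ into $B_{l+1}$, or into a new empty bin if $k=l$. Else if $a\in I_{1p}$ and $c(a)\in(\frac13,\frac12]$: let $m$ be the number of items of $I_{1p}$ not yet packed; if $m\ge k-l$, pack $a$ using Harmonic$_4$, otherwise pack $a$ into $B_{l+1}$. Otherwise, pack $a$ according to the plan (items of $I_{1g}$ together with their planned set, items of $S_i$ into $B_i$), or using Harmonic$_4$ if no plan exists for $a$. *)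

(* Defs.v *)
From HB Require Import structures.
From mathcomp Require Import all_boot all_order all_algebra.
From mathcomp Require Import reals.

Set Implicit Arguments.
Unset Strict Implicit.
Unset Printing Implicit Defensive.

Import Order.TTheory GRing.Theory Num.Theory.
Local Open Scope ring_scope.

(* Items are identified with their position in the list, which is also the    *)
(* order in which they are revealed.                                          *)
Record input (R : realType) := Input {
  nitems : nat;
  est : {ffun 'I_nitems -> R};
  act : {ffun 'I_nitems -> R}
}.

Definition valid_est (R : realType) (n : nat) (c' : {ffun 'I_n -> R}) : Prop :=
  forall a, 0 < c' a <= 1.

Definition valid_input (R : realType) (delta : R) (L : input R) : Prop :=
  valid_est (est L) /\
  forall a, est L a * (1 - delta) <= act L a
            <= Num.min (est L a * (1 + delta)) 1.

Section Optimum.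
Context {R : realType} (L : input R).

(* n bins always suffice for n items, so the bins of an offline packing are   *)
(* named by the elements of 'I_n.                                             *)
Definition packing := {ffun 'I_(nitems L) -> 'I_(nitems L)}.

Definition feasible (p : packing) : bool :=
  [forall b, \sum_(a | p a == b) act L a <= 1].

Definition nbins (p : packing) : nat := #|p @: [set: 'I_(nitems L)]|.

(* The default value nitems L is attained by the packing with one item per    *)
(* bin, which is feasible since actual sizes are at most 1.                   *)
Definition OPT : nat :=
  \big[minn/nitems L]_(p : packing | feasible p) nbins p.

End Optimum.

Definition competitive (R : realType) (delta c : R) (A : input R -> nat) :
    Prop :=
  exists K : R, forall L : input R, valid_input delta L ->
    (A L)%:R <= c * (OPT L)%:R + K.

(* The i-th entry (a, S) of gsets plans the item a of I_1g together with S;   *)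
(* the i-th entry of rsets is the set planned for the i-th reserved bin, with *)
(* indices starting from 0.                                                   *)
Record plan (n : nat) := Plan {
  gsets : seq ('I_n * {set 'I_n});
  rsets : seq {set 'I_n}
}.

Section Planning.
Context {R : realType} (delta : R) {n : nat} (c' : {ffun 'I_n -> R}).

Definition I1g : {set 'I_n} := [set a | (1 - delta) * c' a > 1 / 2].
Definition I1p : {set 'I_n} := [set a | (1 + delta) * c' a > 1 / 2] :\: I1g.
Definition I4p : {set 'I_n} := [set a | (1 - delta) * c' a <= 1 / 4].

(* S is a possible outcome of greedily adding items of F, starting from the   *)
(* empty set, next to an item of estimated size x. When already               *)
(* (1 + delta) * x > 1, no item can be added and S is empty.                  *)
Definition greedy_fill (x : R) (F S : {set 'I_n}) : bool :=
  maxset (fun S' : {set 'I_n} =>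
    (S' \subset F) &&
    ((S' == set0) || ((1 + delta) * (x + \sum_(b in S') c' b) <= 1))) S.

Fixpoint plan_guaranteed (F : {set 'I_n}) (s : seq ('I_n * {set 'I_n})) :
    bool :=
  if s is (a, S0) :: s' then
    greedy_fill (c' a) F S0 && plan_guaranteed (F :\: S0) s'
  else true.

(* F is the set of remaining items of I_4+, and q is the number of iterations *)
(* still allowed.                                                             *)
Fixpoint plan_reserved (q : nat) (F : {set 'I_n}) (s : seq {set 'I_n}) : bool :=
  match q, s with
  | q'.+1, S0 :: s' =>
      [&& F != set0, greedy_fill (1 / (2 * (1 - delta))) F S0
        & plan_reserved q' (F :\: S0) s']
  | 0%N, _ :: _ => false
  | _, [::] => (q == 0%N) || (F == set0)
  end.

(* P is a possible outcome of the planning phase: the order in which I_1g is  *)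
(* processed and the greedy choices are left open.                            *)
Definition valid_plan (P : plan n) : Prop :=
  [/\ perm_eq (unzip1 (gsets P)) (enum I1g),
      plan_guaranteed I4p (gsets P)
    & plan_reserved #|I1p| (I4p :\: \bigcup_(aS <- gsets P) aS.2) (rsets P)].

End Planning.

(* A planner fixes the choices left open by the planning phase; it only sees  *)
(* the estimated sizes.                                                       *)
Definition planner (R : realType) : Type :=
  forall n : nat, {ffun 'I_n -> R} -> plan n.

Definition valid_planner (R : realType) (delta : R) (pl : planner R) : Prop :=
  forall (n : nat) (c' : {ffun 'I_n -> R}),
    valid_est c' -> valid_plan delta c' (pl n c').

(* GBin i is the bin planned by the i-th entry of gsets, RBin i the i-th      *)
(* reserved bin, NewBin a the bin opened for the item a of I_1p when no       *)
(* reserved bin is left, and HBin j i the i-th bin opened by Harmonic_4 for   *)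
(* class I_j.                                                                 *)
Inductive bin (n : nat) : Type :=
| GBin of nat
| RBin of nat
| NewBin of 'I_n
| HBin of nat & nat.
Arguments GBin {n} _.
Arguments RBin {n} _.
Arguments HBin {n} _ _.

Definition bin_code (n : nat) (b : bin n) : nat + nat + 'I_n + nat * nat :=
  match b with
  | GBin i => inl (inl (inl i))
  | RBin i => inl (inl (inr i))
  | NewBin a => inl (inr a)
  | HBin j i => inr (j, i)
  end.

Definition bin_decode (n : nat) (x : nat + nat + 'I_n + nat * nat) : bin n :=
  match x with
  | inl (inl (inl i)) => GBin i
  | inl (inl (inr i)) => RBin i
  | inl (inr a) => NewBin a
  | inr (j, i) => HBin j i
  end.

Lemma bin_codeK (n : nat) : cancel (@bin_code n) (@bin_decode n).
Proof. by case. Qed.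

HB.instance Definition _ (n : nat) :=
  Equality.copy (bin n) (can_type (@bin_codeK n)).

(* The items packed so far with their bins, in the order of packing. *)
Definition history (n : nat) : Type := seq ('I_n * bin n).

Definition content (n : nat) (h : history n) (b : bin n) : seq 'I_n :=
  [seq e.1 | e <- h & e.2 == b].

Section Update.
Context {R : realType} (delta : R) {n : nat} (c' c : {ffun 'I_n -> R}).
Variable P : plan n.

Definition hclass (x : R) : nat :=
  if 1 / 2 < x then 1 else if 1 / 3 < x then 2 else if 1 / 4 < x then 3 else 4.

Definition is_hbin (j : nat) (b : bin n) : bool :=
  if b is HBin j' _ then j' == j else false.

Definition nopened (h : history n) (j : nat) : nat :=
  size (undup [seq b <- unzip2 h | is_hbin j b]).

Definition accepts (j : nat) (s : seq 'I_n) (a : 'I_n) : bool :=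
  if (j <= 3)%N then (size s < j)%N else \sum_(b <- s) c b + c a <= 1.

(* The current open bin of a class is the last one opened. *)
Definition harmonic4 (h : history n) (a : 'I_n) : bin n :=
  let j := hclass (c a) in
  let q := nopened h j in
  if (0 < q)%N && accepts j (content h (HBin j q.-1)) a
  then HBin j q.-1 else HBin j q.

Definition planned_bin (a : 'I_n) : option (bin n) :=
  let i := find (fun aS : 'I_n * {set 'I_n} => (a == aS.1) || (a \in aS.2))
                (gsets P) in
  let r := find (fun S : {set 'I_n} => a \in S) (rsets P) in
  if (i < size (gsets P))%N then Some (GBin i)
  else if (r < size (rsets P))%N then Some (RBin r)
  else None.

(* The item a being revealed counts as not yet packed, hence is included in   *)
(* m. The bin B_(l+1) is RBin l.                                              *)
Definition pack_item (h : history n) (a : 'I_n) : bin n :=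
  let k := size (rsets P) in
  let l := count (fun i => has (mem (I1p delta c')) (content h (RBin i)))
                 (iota 0 k) in
  let m := #|I1p delta c' :\: [set b in unzip1 h]| in
  if (a \in I1p delta c') && (1 / 2 < c a) then
    if l == k then NewBin a else RBin l
  else if (a \in I1p delta c') && (1 / 3 < c a <= 1 / 2) then
    if (k - l <= m)%N then harmonic4 h a else RBin l
  else if planned_bin a is Some b then b else harmonic4 h a.

Definition ph_run : history n :=
  foldl (fun h a => rcons h (a, pack_item h a)) [::] (enum 'I_n).

End Update.

Definition PH (R : realType) (delta : R) (pl : planner R) (L : input R) : nat :=
  size (undup (unzip2 (ph_run delta (est L) (act L) (pl _ (est L))))).

(* Main.v *)
Require Import Defs.
From mathcomp Require Import all_boot all_order all_algebra.
From mathcomp Require Import reals.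
From mathcomp Require Import lra zify.

Set Implicit Arguments.
Unset Strict Implicit.
Unset Printing Implicit Defensive.

Import Order.TTheory GRing.Theory Num.Theory.
Local Open Scope ring_scope.

(* Case 1: the plan does not exhaust I_4+, or a reserved bin receives an item *)
(* of I_1p of size at most 1/2. Then no bin is opened for a large item of     *)
(* I_1p, and every bin, up to one reserved bin and the open Harmonic bins,    *)
(* has volume at least 2/3. Indeed delta <= 1/35 means (1 - delta) / (1 +     *)
(* delta) >= 17/18, so by maximality of the planned sets a bin of an item of  *)
(* I_1g has volume at least 17/18 - 1/4, and a reserved bin holds an item of  *)
(* I_1p of size more than 17/36 and small items of volume at least 17/18 -    *)
(* 1/2 - 1/4 = 7/36, which add up to exactly 2/3.                             *)
(* Case 2: otherwise all of I_4+ is planned and every reserved bin, up to     *)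
(* one, holds an item larger than 1/2. Give an item weight 1, 1/2, 1/3 or 0   *)
(* according to its Harmonic class: the bins of the algorithm, up to a        *)
(* constant number, have weight at least 1, and a set of items that fits into *)
(* one bin has weight at most 3/2.                                            *)

(** Both cases are weighting arguments, with weight [3 / 2 * c a] in case 1 and [class_weight (c a)]
    in case 2. Apart from the five [exceptional_bins], every bin of the algorithm has weight at
    least 1 ([regular_bin_vol], [regular_bin_class]), so [size_bins_le] bounds the number of bins by
    the total weight plus 5. A set that fits into one bin has weight at most 3/2: immediate for
    volume, [class_weight_bin] for classes. So [sum_le_OPT] bounds the total weight by 3/2 times the
    optimum.

    The case is chosen in [ph_size]. By [reserved_inv], a [NewBin] is never opened in a run that
    puts an item of [I1p] of size at most 1/2 into a reserved bin, and it requires fewer reserved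
    bins than items of [I1p], which by [rplan_size] means that I_4+ was exhausted. *)

Lemma sum_subset_le (R : numDomainType) (T : finType) (w : T -> R)
    (A B : {set T}) :
  (forall x, 0 <= w x) -> A \subset B ->
  \sum_(x in A) w x <= \sum_(x in B) w x.
Proof.
move=> w_ge0 AB; rewrite [leRHS](big_setID A) /= (setIidPr AB).
by rewrite lerDl sumr_ge0.
Qed.

(** A feasible packing splits the total into one sum of at most [r] per used bin. The bound passes
    to minima, and at the default value [nitems L] it holds because each item fits alone. *)
Lemma sum_le_OPT (R : realType) (L : input R) (w : 'I_(nitems L) -> R) (r : R) :
  (forall a, act L a <= 1) ->
  (forall B : {set 'I_(nitems L)}, \sum_(a in B) act L a <= 1 ->
     \sum_(a in B) w a <= r) ->
  \sum_a w a <= r * (OPT L)%:R.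
Proof.
move=> act_le1 w_bin; rewrite /OPT.
elim/big_ind: (\big[minn/_]_(p | _) _) => [|x y x_le y_le|p p_feas].
- have: \sum_a w a <= \sum_(a < nitems L) r.
    apply: ler_sum => a _.
    by have := w_bin [set a]; rewrite !big_set1; exact.
  by rewrite sumr_const card_ord mulr_natr.
- by rewrite /minn; case: ifP => _.
- have -> : \sum_a w a = \sum_(a in [set: 'I_(nitems L)]) w a.
    by apply: eq_bigl => a; rewrite inE.
  rewrite (partition_big_imset p) mulr_natr /nbins -sumr_const.
  apply: ler_sum => b _.
  rewrite (eq_bigl (mem [set a | p a == b])); last by move=> a; rewrite !inE.
  apply: w_bin; move/forallP/(_ b): p_feas => /=.
  by rewrite (eq_bigl (mem [set a | p a == b])) // => a; rewrite !inE.
Qed.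

Lemma count_ltn_iota (l k : nat) :
  (l <= k)%N -> count (fun i => i < l)%N (iota 0 k) = l.
Proof.
move=> lk; rewrite -(subnKC lk) iotaD count_cat add0n.
rewrite (eq_in_count (a2 := predT)) => [|i]; last by rewrite mem_iota.
rewrite count_predT size_iota.
rewrite (eq_in_count (a2 := pred0)) ?count_pred0 ?addn0 //.
by move=> i; rewrite mem_iota => /andP[+ _]; rewrite leqNgt => /negbTE.
Qed.

Lemma size_undup_rcons (T : eqType) (s : seq T) (x : T) :
  size (undup (rcons s x)) = ((x \notin s) + size (undup s))%N.
Proof.
have /perm_size -> : perm_eq (undup (rcons s x)) (undup (x :: s)).
  by apply: perm_undup => y; rewrite mem_rcons.
by rewrite /=; case: ifP.
Qed.

Lemma in_bigcup_seq (T : finType) (I : Type) (s : seq I) (F : I -> {set T})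
    (x : T) :
  (x \in \bigcup_(i <- s) F i) = has (fun i => x \in F i) s.
Proof.
by elim: s => [|i s IH]; rewrite ?big_nil ?big_cons ?inE //= IH.
Qed.

(** * Contents of bins and the number of bins used *)

Section Bins.
Context (R : numDomainType) (n : nat).
Implicit Types (h : history n) (w : 'I_n -> R) (b : bin n) (a : 'I_n).

Lemma content_rcons h a b b' :
  content (rcons h (a, b)) b' =
  if b == b' then rcons (content h b') a else content h b'.
Proof.
by rewrite /content filter_rcons /=; case: eqP => //; rewrite map_rcons.
Qed.

Lemma mem_content h a b : (a \in content h b) = ((a, b) \in h).
Proof.
apply/mapP/idP => [[[a' b']]|ab].
  by rewrite mem_filter /= => /andP[/eqP-> h_ab ->].
by exists (a, b) => //; rewrite mem_filter /= eqxx.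
Qed.

Lemma uniq_content h b : uniq (unzip1 h) -> uniq (content h b).
Proof. by apply: subseq_uniq; apply/map_subseq/filter_subseq. Qed.

Lemma sum_content_ge h w b (B : {set 'I_n}) :
  (forall a, 0 <= w a) -> uniq (unzip1 h) ->
  (forall a, a \in B -> (a, b) \in h) ->
  \sum_(a in B) w a <= \sum_(a <- content h b) w a.
Proof.
move=> w_ge0 h_uniq Bh; rewrite big_uniq ?uniq_content //=.
rewrite [leRHS](eq_bigl (mem [set a in content h b])) => [|a].
  2: by rewrite !inE.
by apply: sum_subset_le => //; apply/subsetP => a /Bh; rewrite inE mem_content.
Qed.

(** Double counting: each packed item is charged to its bin, and each bin of [E] costs 1. [E] may
    name bins that were never opened, since only its length enters. *)
Lemma size_bins_le h w (E : seq (bin n)) :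
  (forall a, 0 <= w a) ->
  (forall b, b \in unzip2 h -> b \notin E ->
     1 <= \sum_(a <- content h b) w a) ->
  (size (undup (unzip2 h)))%:R <= \sum_(a <- unzip1 h) w a + (size E)%:R.
Proof.
move=> w_ge0 full; set bs := undup _.
have -> : \sum_(a <- unzip1 h) w a = \sum_(b <- bs) \sum_(a <- content h b) w a.
  rewrite [RHS](eq_bigr (fun b => \sum_(e <- h | e.2 == b) w e.1)) => [|b _].
    2: by rewrite /content big_map big_filter.
  rewrite /unzip1 big_map [RHS](exchange_big_dep predT) //=.
  rewrite [LHS]big_seq [RHS]big_seq; apply: eq_bigr => e e_h.
  rewrite -big_filter.
  have -> : [seq b <- bs | e.2 == b] = [:: e.2]; last by rewrite big_seq1.
  rewrite (eq_filter (a2 := pred1 e.2)) => [|b]; last exact: eq_sym.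
  by apply: filter_pred1_uniq; rewrite ?undup_uniq // mem_undup map_f.
rewrite -(count_predC (mem E) bs) natrD addrC lerD //.
  rewrite -sum1_count natr_sum big_mkcond /= big_seq [leRHS]big_seq.
  apply: ler_sum => b; rewrite mem_undup => b_h.
  case: ifPn => [/full -> //|_]; exact: sumr_ge0.
rewrite ler_nat -size_filter uniq_leq_size ?filter_uniq ?undup_uniq // => b.
by rewrite mem_filter => /andP[].
Qed.

End Bins.

(** * Disjointness and fullness of the planned sets *)

Section Planning.
Context {R : realType} (delta : R) {n : nat} (c' : {ffun 'I_n -> R}).
Implicit Types (F S : {set 'I_n}) (s : seq {set 'I_n})
  (g : seq ('I_n * {set 'I_n})).

Lemma greedy_fill_sub x F S : greedy_fill delta c' x F S -> S \subset F.
Proof. by case/maxsetP => /andP[]. Qed.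

(** If [b] still fitted, [b |: S] would be a larger admissible set. This also covers the empty [S]
    forced by an oversized [x]. *)
Lemma greedy_fill_max x F S b :
  greedy_fill delta c' x F S -> b \in F -> b \notin S ->
  1 < (1 + delta) * (x + \sum_(a in S) c' a + c' b).
Proof.
case/maxsetP => /andP[SF _] S_max bF bS; rewrite ltNge; apply/negP => b_fits.
have/negP := bS; apply.
rewrite -(S_max (b |: S)) ?setU11 ?subsetUr // subUset sub1set bF SF /=.
by rewrite big_setU1 //= [c' b + _]addrC addrA b_fits orbT.
Qed.

Definition gplanned g : {set 'I_n} :=
  \bigcup_(aS <- g) aS.2.

Lemma gplanned_sub F g : plan_guaranteed delta c' F g -> gplanned g \subset F.
Proof.
rewrite /gplanned; elim: g F => [|[a S] g IH] F /=.
  by rewrite big_nil sub0set.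
move=> /andP[/greedy_fill_sub SF /IH sub]; rewrite big_cons subUset SF /=.
exact/(subset_trans sub)/subsetDl.
Qed.

(** Distinct entries share no item: each set is removed from [F] before the next is chosen, and the
    first components are distinct and outside [F]. So the first match is the only one. *)
Lemma find_gplan F g a0 i x :
  plan_guaranteed delta c' F g -> uniq (unzip1 g) ->
  {in unzip1 g, forall a, a \notin F} -> (i < size g)%N ->
  (x == (nth (a0, set0) g i).1) || (x \in (nth (a0, set0) g i).2) ->
  find (fun aS : 'I_n * {set 'I_n} => (x == aS.1) || (x \in aS.2)) g = i.
Proof.
elim: g F i => [|[a S] g IH] F [|i] //=; first by move=> _ _ _ _ ->.
move=> /andP[/greedy_fill_sub SF gs] /andP[a_g g_uniq] g_F i_g x_i.
have -> : ((x == a) || (x \in S)) = false.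
  have gi_g := mem_nth (a0, set0) i_g.
  case/orP: x_i => [/eqP ->|x_i].
    rewrite (negbTE (memPn a_g _ _)) ?map_f //=.
    by apply/(contraNF (subsetP SF _))/g_F; rewrite inE map_f ?orbT.
  have: x \in gplanned g.
    by rewrite /gplanned in_bigcup_seq; apply/hasP; exists (nth (a0, set0) g i).
  move=> /(subsetP (gplanned_sub gs)); rewrite inE => /andP[/negbTE-> xF].
  by rewrite orbF; apply: contraTF xF => /eqP->; apply: g_F; rewrite inE eqxx.
congr _.+1; apply: (IH _ _ gs) => // b b_g.
by rewrite inE negb_and g_F ?orbT // inE b_g orbT.
Qed.

(** An item left at the end was available at every step, so it fitted next to none of the sets. *)
Lemma gplan_full F g a0 i b :
  plan_guaranteed delta c' F g -> (i < size g)%N -> b \in F :\: gplanned g ->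
  1 < (1 + delta) * (c' (nth (a0, set0) g i).1
                     + \sum_(a in (nth (a0, set0) g i).2) c' a + c' b).
Proof.
rewrite /gplanned; elim: g F i => [|[a S] g IH] F [|i] //= /andP[S_fill gs];
  rewrite big_cons setDUr !inE /=.
  by move=> _ /andP[/andP[bS bF] _]; exact: (greedy_fill_max S_fill).
move=> i_g /andP[/andP[bS bF] /andP[b_g _]]; apply: IH gs i_g _.
by rewrite !inE bS bF b_g.
Qed.

Definition rplanned s : {set 'I_n} := \bigcup_(S <- s) S.

Lemma rplanned_sub q F s : plan_reserved delta c' q F s -> rplanned s \subset F.
Proof.
rewrite /rplanned; elim: s q F => [|S s IH] [|q] F //=;
  rewrite ?big_nil ?sub0set //.
move=> /and3P[_ /greedy_fill_sub SF /IH sub]; rewrite big_cons subUset SF /=.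
exact/(subset_trans sub)/subsetDl.
Qed.

Lemma find_rplan q F s i x :
  plan_reserved delta c' q F s -> (i < size s)%N -> x \in nth set0 s i ->
  find (fun S => x \in S) s = i.
Proof.
elim: s q F i => [|S s IH] [|q] F [|i] //=; first by move=> _ _ ->.
move=> /and3P[_ _ gs] i_s x_i; have si_s := mem_nth set0 i_s.
have: x \in rplanned s.
  by rewrite /rplanned in_bigcup_seq; apply/hasP; exists (nth set0 s i).
move=> /(subsetP (rplanned_sub gs)); rewrite inE => /andP[/negbTE-> _].
by congr _.+1; apply: IH gs i_s x_i.
Qed.

(** The loop stops early only once [F] is exhausted, so a leftover item forces all [q]
    iterations. *)
Lemma rplan_size q F s :
  plan_reserved delta c' q F s ->
  (size s <= q)%N /\ (F :\: rplanned s != set0 -> size s = q).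
Proof.
rewrite /rplanned; elim: s q F => [|S s IH] [|q] F //=.
  by rewrite big_nil setD0 => ->.
move=> /and3P[_ _ /IH[s_q s_eq]]; split => //.
by rewrite big_cons -setDDl => /s_eq ->.
Qed.

Lemma rplan_nil q F s :
  plan_reserved delta c' q F s -> (0 < size s)%N -> F != set0.
Proof. by case: s q => [|S s] [|q] //= /and3P[]. Qed.

(** That iteration [i.+1] took place shows that some item was left after set [i], and this item did
    not fit. The last set has no such witness. *)
Lemma rplan_full q F s i :
  plan_reserved delta c' q F s -> (i.+1 < size s)%N ->
  exists2 b, b \in F &
    1 < (1 + delta) *
        (1 / (2 * (1 - delta)) + \sum_(a in nth set0 s i) c' a + c' b).
Proof.
elim: s q F i => [|S s IH] [|q] F [|i] //= /and3P[F0 S_fill gs].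
  move=> /(rplan_nil gs)/set0Pn[b]; rewrite inE => /andP[bS bF].
  by exists b => //; exact: (greedy_fill_max S_fill).
move=> i_s; have [b] := IH _ _ _ gs i_s.
by rewrite inE => /andP[_ bF] ?; exists b.
Qed.

End Planning.

(** * Weights of the Harmonic classes *)

(** Class 4 can have weight 0 because the weight serves only when all of I_4+ is planned, so that
    Harmonic opens no bin for that class. *)
Definition class_weight (R : numFieldType) (x : R) : R :=
  if 1 / 2 < x then 1 else if 1 / 3 < x then 1 / 2
  else if 1 / 4 < x then 1 / 3 else 0.

Section ClassWeight.
Context {R : realFieldType}.

Lemma class_weight_ge0 (x : R) : 0 <= class_weight x.
Proof. by rewrite /class_weight; do 3?[case: ifP => _]; lra. Qed.

Lemma class_weight_vol (x : R) : 0 <= x <= 1 / 2 -> class_weight x <= 3 / 2 * x.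
Proof.
move=> x_bnd; rewrite /class_weight.
by case: ltP => [|_]; [lra|do 2?[case: ltP => ?]; lra].
Qed.

(** Two items above 1/4 would exceed the total, so at most one item has positive weight, and its
    size is below 1/2. *)
Lemma class_weight_half (T : finType) (c : T -> R) (B : {set T}) :
  (forall a, 0 <= c a) -> \sum_(a in B) c a < 1 / 2 ->
  \sum_(a in B) class_weight (c a) <= 1 / 2.
Proof.
move=> c_ge0 B_small.
have c_le a : a \in B -> c a <= \sum_(a in B) c a.
  by move=> aB; rewrite (big_setD1 a) //= lerDl sumr_ge0.
have [/exists_inP[x xB x_gt]|no_big] := boolP [exists x in B, 1 / 4 < c x].
  rewrite (big_setD1 x) //= big1 ?addr0 => [|a].
    have := c_le _ xB; rewrite /class_weight; case: ltP => [|_]; first lra.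
    by do 2?[case: ltP => ?]; lra.
  rewrite !inE => /andP[ax aB].
  have : c x + c a <= \sum_(a in B) c a.
    rewrite (big_setD1 x) //= (big_setD1 a) ?inE ?ax //= addrA lerDl.
    exact: sumr_ge0.
  by rewrite /class_weight => xa; do 3?[case: ltP => [|_]; first lra].
rewrite big1 => [|a aB]; first by lra.
have := exists_inPn no_big a aB; rewrite -leNgt => a_le.
by rewrite /class_weight; do 3?[case: ltP => [|_]; first lra].
Qed.

(** Next to an item above 1/2 less than 1/2 of room remains, giving 1 + 1/2. Without such an item,
    weight per volume is at most 3/2, the extreme being class 2 just above 1/3. *)
Lemma class_weight_bin (T : finType) (c : T -> R) (B : {set T}) :
  (forall a, 0 <= c a) -> \sum_(a in B) c a <= 1 ->
  \sum_(a in B) class_weight (c a) <= 3 / 2.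
Proof.
move=> c_ge0 B_le1.
have [/exists_inP[x xB x_gt]|no_big] := boolP [exists x in B, 1 / 2 < c x].
  move: B_le1; rewrite !(big_setD1 x xB) /= => B_le1.
  have: \sum_(a in B :\ x) class_weight (c a) <= 1 / 2.
    by apply: class_weight_half => //; lra.
  by rewrite {2}/class_weight x_gt; lra.
have: \sum_(a in B) class_weight (c a) <= \sum_(a in B) 3 / 2 * c a.
  apply: ler_sum => a aB; apply: class_weight_vol.
  by have := exists_inPn no_big a aB; rewrite -leNgt c_ge0.
by rewrite -mulr_sumr; lra.
Qed.

End ClassWeight.

(** * Invariants of the run: Harmonic bins *)

Section Run.
Context {R : realType} (delta : R) {n : nat} (c' c : {ffun 'I_n -> R}).
Context (P : plan n).
Implicit Types (h : history n) (s : seq 'I_n) (a : 'I_n) (b : bin n).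

Local Notation k := (size (rsets P)).
Local Notation I1p := (I1p delta c').
Local Notation pack := (pack_item delta c' c P).

Lemma eq_HBin j i j' i' :
  (HBin j i == HBin j' i' :> bin n) = (j == j') && (i == i').
Proof. by apply/eqP/andP => [[-> ->]|[/eqP-> /eqP->]]. Qed.

Lemma eq_RBin i i' : (RBin i == RBin i' :> bin n) = (i == i').
Proof. by apply/eqP/eqP => [[->]|->]. Qed.

Lemma is_hbinP j b : reflect (exists i, b = HBin j i) (is_hbin j b).
Proof.
apply: (iffP idP) => [|[i ->] /=]; last exact: eqxx.
by case: b => //= j' i /eqP->; exists i.
Qed.

Lemma is_hbin_planned a b j : planned_bin P a = Some b -> is_hbin j b = false.
Proof.
by rewrite /planned_bin; case: ifP => _; [|case: ifP => _] => // -[<-].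
Qed.

Lemma nopened_rcons h a b j :
  nopened (rcons h (a, b)) j =
  ((is_hbin j b && (b \notin unzip2 h)) + nopened h j)%N.
Proof.
rewrite /nopened /unzip2 map_rcons filter_rcons /=.
by case: ifP => // jb; rewrite size_undup_rcons mem_filter jb.
Qed.

Lemma hclassP (x : R) :
  match hclass x with
  | 1 => 1 / 2 < x /\ class_weight x = 1
  | 2 => 1 / 3 < x /\ class_weight x = 1 / 2
  | 3 => 1 / 4 < x /\ class_weight x = 1 / 3
  | 4 => x <= 1 / 4
  | _ => False
  end.
Proof. by rewrite /hclass /class_weight; do 3?case: ltP. Qed.

Definition harmonic_full (j : nat) s : bool :=
  if (j <= 3)%N then (j <= size s)%N else 3 / 4 <= \sum_(a <- s) c a.

(** Numbering without gaps makes the last index the open bin; only that bin may fail to be full. *)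
Definition harmonic_inv h : Prop := forall j,
  (forall i, (HBin j i \in unzip2 h) = (i < nopened h j)%N) /\
  (forall i, (i.+1 < nopened h j)%N -> harmonic_full j (content h (HBin j i))).

(** For class 4, the rejected item has size at most 1/4, so the content exceeds 3/4. *)
Lemma not_accepts_full a s :
  ~~ accepts c (hclass (c a)) s a -> harmonic_full (hclass (c a)) s.
Proof.
rewrite /accepts /harmonic_full; have := hclassP (c a).
case: hclass => [|[|[|[|[|]]]]] //=; rewrite -?leqNgt // => a_le.
rewrite -ltNge; lra.
Qed.

Lemma harmonic_inv_other h a b j :
  is_hbin j b = false -> forall i,
  (HBin j i \in unzip2 (rcons h (a, b))) = (HBin j i \in unzip2 h) /\
  content (rcons h (a, b)) (HBin j i) = content h (HBin j i).
Proof.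
move=> jb i; have bj : b == HBin j i = false.
  by apply: contraFF jb => /eqP-> /=.
by rewrite content_rcons bj /unzip2 map_rcons mem_rcons inE eq_sym bj.
Qed.

Lemma harmonic_inv_rcons h a b :
  harmonic_inv h -> b = harmonic4 c h a \/ (forall j, is_hbin j b = false) ->
  harmonic_inv (rcons h (a, b)).
Proof.
move=> h_inv b_h j; have [h_mem h_full] := h_inv j.
have [/is_hbinP[i0 b_eq]|jb] := boolP (is_hbin j b); last first.
  have other := harmonic_inv_other h a (negbTE jb).
  split=> i; rewrite nopened_rcons (negbTE jb) add0n.
    by rewrite (other i).1.
  rewrite (other i).2; exact: h_full.
case: b_h => [b_h|/(_ j)]; last by rewrite b_eq /= eqxx.
move: b_h; rewrite b_eq /harmonic4.
set j' := hclass (c a); set q := nopened h j'.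
have mem_step i i1 : (HBin j i \in unzip2 (rcons h (a, HBin j i1))) =
    (i == i1) || (i < nopened h j)%N.
  by rewrite /unzip2 map_rcons mem_rcons inE eq_HBin eqxx h_mem.
have content_step i i1 : i != i1 ->
    content (rcons h (a, HBin j i1)) (HBin j i) = content h (HBin j i).
  by rewrite content_rcons eq_HBin eqxx eq_sym => /negbTE->.
case: ifP => [/andP[q0 _]|accN] [jj' ->]; subst j.
  split=> i; rewrite ?mem_step nopened_rcons /= h_mem -/q eqxx.
    by rewrite /=; lia.
  move=> iq; rewrite content_step; last by lia.
  by apply: h_full; lia.
split=> i; rewrite ?mem_step nopened_rcons /= h_mem -/q eqxx.
  by rewrite /=; lia.
move=> iq; rewrite content_step; last by lia.
(* The only bin newly required to be full is the one just closed, of index [q.-1], which rejected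
   [a]. *)
have [/h_full //|iq'] := ltnP i.+1 q.
have i_eq : i = q.-1 by lia.
rewrite i_eq; apply: not_accepts_full; move: accN.
by rewrite (_ : (0 < q)%N = true) ?andTb => [->|]; last by lia.
Qed.

(** [ph_run] is the instance [s = enum 'I_n]; a general [s] allows induction on prefixes. *)
Definition run s : history n := foldl (fun h a => rcons h (a, pack h a)) [::] s.

Lemma run_rcons s a : run (rcons s a) = rcons (run s) (a, pack (run s) a).
Proof. by rewrite /run foldl_rcons. Qed.

Lemma unzip1_run s : unzip1 (run s) = s.
Proof.
elim/last_ind: s => //= s a IH.
by rewrite run_rcons /unzip1 map_rcons -/(unzip1 _) IH.
Qed.

Lemma run_entry s a b : (a, b) \in run s -> exists h, b = pack h a.
Proof.
elim/last_ind: s => // s x IH; rewrite run_rcons mem_rcons inE.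
by case/orP => [/eqP[-> ->]|/IH //]; exists (run s).
Qed.

Lemma harmonic_inv_run s : harmonic_inv (run s).
Proof.
elim/last_ind: s => [j|s a IH]; first by split.
rewrite run_rcons; apply: harmonic_inv_rcons => //.
rewrite /pack_item; case: ifP => _; first by case: ifP => _; right.
case: ifP => _; first by case: ifP => _; [left|right].
by case def_b: (planned_bin P a) => [b|];
  [right=> j; exact: is_hbin_planned def_b|left].
Qed.

Lemma pack_planned h a b :
  a \notin I1p -> planned_bin P a = Some b -> pack h a = b.
Proof. by rewrite /pack_item => /negbTE-> ->. Qed.

Context (I1p_gt : forall a, a \in I1p -> 1 / 3 < c a).

(** Items of [I1p] exceed 1/3, so they never reach the branch that follows the plan. *)
Lemma pack_itemP h a :
  match pack h a with
  | GBin i => planned_bin P a = Some (GBin i)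
  | RBin i => (i < k)%N
  | NewBin a' => [/\ a' = a, a \in I1p & 1 / 2 < c a]
  | HBin j i => j = hclass (c a) /\
      (a \in I1p -> c a <= 1 / 2) /\ (a \notin I1p -> planned_bin P a = None)
  end.
Proof.
rewrite /pack_item; set l := count _ _.
have l_k : (l <= k)%N by rewrite -[leqRHS](size_iota 0); exact: count_size.
have [aI|aI] := boolP (a \in I1p) => /=.
  rewrite I1p_gt //=; case: ltP => [a_gt|a_le].
    case: eqP => // /eqP lk; lia.
  rewrite /harmonic4; case: ifP => [_|/negbT]; last by rewrite -ltnNge; lia.
  by case: ifP.
case def_b: (planned_bin P a) => [b|]; last by rewrite /harmonic4; case: ifP.
move: def_b; rewrite /planned_bin; case: ifP => _; first by case=> <-.
by case: ifP => // r_k [<-].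
Qed.

(** * Invariants of the run: reserved bins and items of [I1p] *)

Definition reserved_used h i : bool := has (mem I1p) (content h (RBin i)).

Lemma reserved_used_rcons h a b i :
  reserved_used (rcons h (a, b)) i =
  reserved_used h i || ((b == RBin i) && (a \in I1p)).
Proof.
rewrite /reserved_used content_rcons; case: ifP => _; last by rewrite orbF.
by rewrite has_rcons orbC.
Qed.

Definition left_I1p s : nat := #|I1p :\: [set b in s]|.

Lemma left_I1p_rcons s a :
  a \notin s -> left_I1p s = ((a \in I1p) + left_I1p (rcons s a))%N.
Proof.
move=> a_s; rewrite /left_I1p (cardsD1 a) !inE a_s /=.
congr (_ + #|pred_of_set _|)%N.
by apply/setP => x; rewrite !inE mem_rcons inE negb_or andbA.
Qed.

(* A reserved bin receives an item of size at most 1/2 only once fewer items  *)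
(* of I_1p are left than reserved bins without one; from then on no item of   *)
(* I_1p goes elsewhere, so at most one reserved bin ends without such an item *)
(* and no bin is opened for a large one.                                      *)
Definition reserved_inv s (l : nat) : Prop :=
  [/\ [/\ (l <= k)%N, (k <= l + left_I1p s + 1)%N
        & (l + left_I1p s <= #|I1p|)%N],
      forall i, (i < k)%N -> reserved_used (run s) i = (i < l)%N,
      forall x a, (x, NewBin a) \in run s -> l = k /\ (k < #|I1p|)%N
    & forall x i, (x, RBin i) \in run s -> x \in I1p -> c x <= 1 / 2 ->
        (l + left_I1p s < k)%N].

Lemma reserved_inv_run s :
  (k <= #|I1p|)%N -> uniq s -> exists l, reserved_inv s l.
Proof.
have left0 : left_I1p [::] = #|I1p| by apply: eq_card => x; rewrite !inE.
rewrite /reserved_inv; move: #|I1p| left0 => N left0 k_le.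
elim/last_ind: s => [_|s a IH].
  by exists 0%N; split=> //; rewrite left0; split=> //; lia.
rewrite rcons_uniq => /andP[a_s /IH[l [[l_k k_m l_m] used new med]]].
have := left_I1p_rcons a_s; rewrite run_rcons.
set m := left_I1p s in k_m l_m med *; set m' := left_I1p _ => m_eq.
(* The reserved bins holding an item of [I1p] form an initial segment, so the counter computed by
   [pack_item] is [l]. *)
have l_eq : count (reserved_used (run s)) (iota 0 k) = l.
  rewrite -[RHS](count_ltn_iota l_k); apply: eq_in_count => i.
  by rewrite mem_iota => /used.
have := erefl (pack (run s) a); rewrite [in RHS]/pack_item unzip1_run.
rewrite -/(left_I1p s) -/m -/reserved_used l_eq.
have mem_run x b : (x, b) \in rcons (run s) (a, pack (run s) a) =
    ((x, b) == (a, pack (run s) a)) || ((x, b) \in run s).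
  by rewrite mem_rcons inE.
have not_reserved : (forall i, pack (run s) a != RBin i) \/ a \notin I1p ->
  forall i, (i < k)%N ->
  reserved_used (rcons (run s) (a, pack (run s) a)) i = (i < l)%N.
  move=> aR i i_k; rewrite reserved_used_rcons used //.
  by case: aR => [/(_ i)/negbTE->|/negbTE->]; rewrite ?andbF orbF.
have reserved : pack (run s) a = RBin l -> a \in I1p ->
  forall i, (i < k)%N ->
  reserved_used (rcons (run s) (a, pack (run s) a)) i = (i < l.+1)%N.
  move=> -> aI i i_k; rewrite reserved_used_rcons used // eq_RBin aI andbT.
  by rewrite ltnS orbC [RHS]leq_eqVlt [l == i]eq_sym.
have [aI|aI] := boolP (a \in I1p) => /=.
  rewrite aI I1p_gt //= in m_eq reserved not_reserved *.
  case: ltP => [a_gt|a_le].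
    case: eqP => lk b_eq.
      exists l; split; first (by split; lia).
      - by apply: not_reserved; left => i; rewrite b_eq.
      - move=> x a'; rewrite mem_run => /orP[_|/new //]; lia.
      - move=> x i; rewrite mem_run b_eq => /orP[/eqP[]//|/med H] xI x_le.
        by have := H xI x_le; lia.
    exists l.+1; split; first (by split; lia).
    - exact: reserved.
    - by move=> x a'; rewrite mem_run b_eq => /orP[/eqP[]//|/new []].
    - move=> x i; rewrite mem_run.
      case/orP=> [/eqP[-> _] _|/med H xI /(H xI)]; last by lia.
      by rewrite leNgt a_gt.
  (* Harmonic requires [k - l <= m] with [a] counted in [m]; packing [a] lowers [m] by one, whence
     the slack of 1 in the invariant. *)
  case: ifP => km b_eq.
    have notR i : pack (run s) a != RBin i.
      by rewrite b_eq /harmonic4; case: ifP.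
    exists l; split; first (by split; lia).
    - by apply: not_reserved; left.
    - move=> x a'; rewrite mem_run b_eq => /orP[/eqP[_]|/new //].
      by rewrite /harmonic4; case: ifP.
    - move=> x i; rewrite mem_run.
      case/orP=> [/eqP[_ b_R]|/med H xI /(H xI)]; last by lia.
      by have := notR i; rewrite -b_R eqxx.
  (* Now [l + m < k]; [l] grows as [m] shrinks, so the sum stays below [k], which also excludes any
     [NewBin]. *)
  exists l.+1; split; first (by split; lia).
  - exact: reserved.
  - move=> x a'; rewrite mem_run b_eq => /orP[/eqP[]//|/new []]; lia.
  - move=> *; lia.
rewrite (negbTE aI) add0n in m_eq.
move=> _; exists l; rewrite -m_eq; split=> //.
- by apply: not_reserved; right.
- move=> x a'; rewrite mem_run => /orP[/eqP[_ b_eq]|/new //].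
  have := pack_itemP (run s) a; rewrite -b_eq => -[_ aI' _].
  by rewrite aI' in aI.
- move=> x i; rewrite mem_run => /orP[/eqP[-> _]|/med //].
  by rewrite (negbTE aI).
Qed.

End Run.

(** * Volume and weight of the bins after the run *)

Section Analysis.
Context {R : realType} (delta : R) {n : nat} (c' c : {ffun 'I_n -> R}).
Context (P : plan n).
Context (delta_gt0 : 0 < delta) (delta_le : delta <= 1 / 35).
Context (c'_gt0 : forall a, 0 < c' a).
Context (c_ge : forall a, (1 - delta) * c' a <= c a).
Context (c_le : forall a, c a <= (1 + delta) * c' a).
Context (P_valid : valid_plan delta c' P).
Implicit Types (a x : 'I_n) (b : bin n).

Local Notation k := (size (rsets P)).
Local Notation I1g := (I1g delta c').
Local Notation I1p := (I1p delta c').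
Local Notation I4p := (I4p delta c').
Local Notation unguaranteed := (I4p :\: gplanned (gsets P)).
Local Notation unplanned := (unguaranteed :\: rplanned (rsets P)).

(** The ratio (1 - delta) / (1 + delta) equals 17/18 at [delta = 1 / 35]. This turns planned
    fullness into a bound on actual volume. *)
Lemma accuracy_ratio (y z : R) :
  0 <= z -> y < (1 + delta) * z -> 17 / 18 * y < (1 - delta) * z.
Proof.
move=> z_ge0 yz; suff: 0 <= (1 - 35 * delta) * z by lra.
by apply: mulr_ge0 => //; move: delta_le; lra.
Qed.

Lemma size_gt0 a : 0 < c a.
Proof.
by apply: lt_le_trans (c_ge a); apply: mulr_gt0 => //; move: delta_le; lra.
Qed.

Lemma I1g_gt a : a \in I1g -> 1 / 2 < c a.
Proof. by rewrite inE => /lt_le_trans; apply. Qed.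

Lemma est_I1p a : a \in I1p -> 17 / 36 < (1 - delta) * c' a.
Proof.
rewrite !inE => /andP[_ /(accuracy_ratio (ltW (c'_gt0 a)))]; lra.
Qed.

Lemma I1p_gt a : a \in I1p -> 17 / 36 < c a.
Proof. by move=> /est_I1p/lt_le_trans; apply. Qed.

Lemma I1p_gt_third a : a \in I1p -> 1 / 3 < c a.
Proof. by move/I1p_gt; lra. Qed.

Lemma I1g_notin_I1p a : a \in I1g -> a \notin I1p.
Proof. by rewrite [a \in I1p]in_setD => ->. Qed.

Lemma I4p_notin_I1g a : a \in I4p -> a \notin I1g.
Proof. by rewrite !inE => a_le; rewrite -leNgt; lra. Qed.

Lemma I4p_notin_I1p a : a \in I4p -> a \notin I1p.
Proof. by move=> a4; apply/negP => /est_I1p; move: a4; rewrite inE; lra. Qed.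

Lemma large_item a : 1 / 2 < c a -> a \notin I1p -> a \in I1g.
Proof.
move=> a_gt; rewrite [a \in I1p]in_setD negb_and negbK => /orP[//|].
by rewrite inE => /negP[]; exact: lt_le_trans (c_le a).
Qed.

Lemma small_item a : c a <= 1 / 4 -> a \in I4p.
Proof. by rewrite inE; exact: le_trans. Qed.

Lemma mem_gsets a : (a \in unzip1 (gsets P)) = (a \in I1g).
Proof. by case: P_valid => /perm_mem-> _ _; rewrite mem_enum. Qed.

Lemma gsets_uniq : uniq (unzip1 (gsets P)).
Proof. by case: P_valid => /perm_uniq-> _ _; exact: enum_uniq. Qed.

Lemma planned_g x a0 i :
  (i < size (gsets P))%N ->
  (x == (nth (a0, set0) (gsets P) i).1)
  || (x \in (nth (a0, set0) (gsets P) i).2) ->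
  planned_bin P x = Some (GBin i).
Proof.
case: P_valid => _ gs _ i_s x_i; rewrite /planned_bin.
have g_I4p : {in unzip1 (gsets P), forall a, a \notin I4p}.
  by move=> a; rewrite mem_gsets; apply: contraL; exact: I4p_notin_I1g.
by rewrite (find_gplan gs gsets_uniq g_I4p i_s x_i) i_s.
Qed.

(** [planned_bin] searches [gsets] first, but [x] was still in I_4+ after those sets were removed,
    so no entry there matches. *)
Lemma planned_r x i :
  (i < k)%N -> x \in nth set0 (rsets P) i -> planned_bin P x = Some (RBin i).
Proof.
case: P_valid => _ gs rs i_k x_i.
rewrite /planned_bin (find_rplan rs i_k x_i) i_k -has_find.
case: hasP => // -[aS aS_g x_aS].
have: x \in rplanned (rsets P).
  rewrite /rplanned in_bigcup_seq; apply/hasP.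
  by exists (nth set0 (rsets P) i); rewrite ?mem_nth.
move=> /(subsetP (rplanned_sub rs)); rewrite !inE => /andP[x_g x_4].
case/orP: x_aS => [/eqP x_eq|x_aS].
  have := I4p_notin_I1g (a := x); rewrite inE x_4 => /(_ isT).
  by rewrite -mem_gsets x_eq map_f.
by move: x_g; rewrite in_bigcup_seq => /hasP[]; exists aS.
Qed.

Lemma planned_none a :
  planned_bin P a = None ->
  [/\ a \notin I1g, a \notin gplanned (gsets P) & a \notin rplanned (rsets P)].
Proof.
rewrite /planned_bin -!has_find; case: ifP => // /negbT g_N.
case: ifP => // /negbT r_N _; rewrite -mem_gsets; split.
- apply: contra g_N => /mapP[aS aS_g ->]; apply/hasP; exists aS => //.
  by rewrite eqxx.
- apply: contra g_N; rewrite /gplanned in_bigcup_seq.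
  apply: sub_has => aS /= ->; exact: orbT.
- by apply: contra r_N; rewrite /rplanned in_bigcup_seq.
Qed.

Local Notation h := (run delta c' c P (enum 'I_n)).

Lemma run_planned x b :
  x \notin I1p -> planned_bin P x = Some b -> (x, b) \in h.
Proof.
move=> x_p x_b; have: x \in unzip1 h by rewrite unzip1_run mem_enum.
case/mapP => -[x1 b1] /= xb1 x_eq; rewrite -{}x_eq in xb1.
have [h' b1_eq] := run_entry xb1.
by rewrite (pack_planned _ _ x_p x_b) in b1_eq; subst b1.
Qed.

Lemma run_uniq : uniq (unzip1 h).
Proof. by rewrite unzip1_run enum_uniq. Qed.

Lemma vol_ge (B : {set 'I_n}) :
  (1 - delta) * \sum_(a in B) c' a <= \sum_(a in B) c a.
Proof. by rewrite mulr_sumr; apply: ler_sum => a _; exact: c_ge. Qed.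

Lemma I4p_est x : x \in I4p -> (1 - delta) * c' x <= 1 / 4.
Proof. by rewrite inE. Qed.

Lemma gbin_vol a0 i :
  unguaranteed != set0 -> (i < size (gsets P))%N ->
  2 / 3 <= \sum_(a <- content h (GBin i)) c a.
Proof.
case: P_valid => _ gs _ /set0Pn[b b_left] i_s.
have full := gplan_full a0 gs i_s b_left.
have planned := planned_g (a0 := a0) i_s.
have : (nth (a0, set0) (gsets P) i).1 \in I1g.
  by rewrite -mem_gsets map_f ?mem_nth.
have : (nth (a0, set0) (gsets P) i).2 \subset I4p.
  apply: subset_trans (gplanned_sub gs); apply/subsetP => x x_i.
  rewrite /gplanned in_bigcup_seq; apply/hasP.
  by exists (nth (a0, set0) (gsets P) i); rewrite ?mem_nth.
case: nth full planned => x S /= full planned S4 x1.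
have xS : x \notin S by apply: contraL x1 => /(subsetP S4)/I4p_notin_I1g.
apply: le_trans (sum_content_ge (B := x |: S) _ run_uniq _); last first.
- move=> y; rewrite in_setU1 => y_xS; apply: run_planned (planned _ y_xS).
  case/orP: y_xS => [/eqP->|/(subsetP S4)/I4p_notin_I1p //].
  exact: I1g_notin_I1p.
- by move=> y; apply/ltW/size_gt0.
rewrite big_setU1 //=.
have S_ge0 : 0 <= \sum_(a in S) c' a.
  by apply: sumr_ge0 => y _; apply/ltW/c'_gt0.
(* The leftover [b] accounts for at most 1/4 of more than 17/18, and 17/18 - 1/4 = 25/36 exceeds
   2/3. *)
have := accuracy_ratio
  (addr_ge0 (addr_ge0 (ltW (c'_gt0 x)) S_ge0) (ltW (c'_gt0 b))) full.
have : b \in I4p by case/setDP: b_left.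
move=> /I4p_est; have := vol_ge S; have := c_ge x; lra.
Qed.

Lemma reserved_setup :
  exists l, reserved_inv delta c' c P (enum 'I_n) l /\ (k <= l + 1)%N.
Proof.
case: P_valid => _ _ /rplan_size[k_le _].
have [l l_inv] := reserved_inv_run I1p_gt_third k_le (enum_uniq 'I_n).
exists l; split=> //; case: l_inv => -[_ + _] _ _ _.
rewrite (_ : left_I1p _ _ _ = 0%N) ?addn0 //.
by apply/eqP; rewrite cards_eq0; apply/eqP/setP => x; rewrite !inE mem_enum.
Qed.

Lemma rbin_item i : (i.+1 < k)%N -> exists2 x, x \in I1p & (x, RBin i) \in h.
Proof.
move=> i_k; have [l [[_ used _ _] k_l]] := reserved_setup.
have : reserved_used delta c' h i by rewrite used; lia.
by case/hasP => x; rewrite mem_content; exists x.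
Qed.

Lemma rbin_vol i :
  (i.+1 < k)%N -> 2 / 3 <= \sum_(a <- content h (RBin i)) c a.
Proof.
move=> i_k; have [x xI x_h] := rbin_item i_k.
case: P_valid => _ gs rs; have [b b_left full] := rplan_full rs i_k.
have planned := planned_r (ltnW i_k).
have : nth set0 (rsets P) i \subset I4p.
  apply: subset_trans (subset_trans (rplanned_sub rs) (subsetDl _ _)).
  apply/subsetP => y y_i; rewrite /rplanned in_bigcup_seq; apply/hasP.
  by exists (nth set0 (rsets P) i); rewrite ?mem_nth 1?ltnW.
move: planned full; set S := nth _ _ _ => planned full S4.
have xS : x \notin S by apply: contraL xI => /(subsetP S4)/I4p_notin_I1p.
apply: le_trans (sum_content_ge (B := x |: S) _ run_uniq _); last first.
- move=> y; rewrite in_setU1 => /orP[/eqP->//|yS].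
  by apply: run_planned (planned _ yS); exact/I4p_notin_I1p/(subsetP S4).
- by move=> y; apply/ltW/size_gt0.
rewrite big_setU1 //=.
have d_lt1 : 0 < 1 - delta by move: delta_le; lra.
have S_ge0 : 0 <= \sum_(a in S) c' a.
  by apply: sumr_ge0 => y _; apply/ltW/c'_gt0.
have half_ge0 : 0 <= 1 / (2 * (1 - delta)) by apply: divr_ge0; lra.
(* The factor [1 - delta] turns the size set aside for the item of [I1p] into exactly 1/2. *)
have half : (1 - delta) * (1 / (2 * (1 - delta))) = 1 / 2.
  by rewrite !mul1r invfM mulrCA divff ?gt_eqF // mulr1.
have := accuracy_ratio
  (addr_ge0 (addr_ge0 half_ge0 S_ge0) (ltW (c'_gt0 b))) full.
rewrite 2!mulrDr half.
have : b \in I4p by case/setDP: b_left.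
move=> /I4p_est; have := vol_ge S; have := I1p_gt xI; lra.
Qed.

Lemma hbin_entry a j i :
  (a, HBin j i) \in h ->
  [/\ j = hclass (c a), a \in I1p -> c a <= 1 / 2
    & a \notin I1p -> planned_bin P a = None].
Proof.
case/run_entry=> h' b_eq; have := pack_itemP P I1p_gt_third h' a.
by rewrite -b_eq => -[-> []].
Qed.

(** A general [w] serves both the volume and the class weight. *)
Lemma hbin_class_ge j i (w : 'I_n -> R) (r : R) :
  (forall a, hclass (c a) = j -> r <= w a) -> 0 <= r -> (j <= 3)%N ->
  harmonic_full c j (content h (HBin j i)) ->
  j%:R * r <= \sum_(a <- content h (HBin j i)) w a.
Proof.
move=> w_ge r_ge0 j_le3; rewrite /harmonic_full j_le3.
set s := content _ _ => s_j.
apply: (@le_trans _ _ (\sum_(a <- s) r)).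
  rewrite big_const_seq count_predT iter_addr_0 -[r *+ _]mulr_natl ler_wpM2r //.
  by rewrite ler_nat.
rewrite big_seq [leRHS]big_seq; apply: ler_sum => a; rewrite mem_content.
by case/hbin_entry => j_eq _ _; apply: w_ge.
Qed.

(** Its length is the additive constant 5 of the theorem: the last reserved bin and the open bin of
    each class. *)
Definition exceptional_bins : seq (bin n) :=
  RBin k.-1 :: [seq HBin j (nopened h j).-1 | j <- iota 1 4].

Lemma hbin_regular a j i :
  (a, HBin j i) \in h -> HBin j i \notin exceptional_bins ->
  harmonic_full c j (content h (HBin j i)).
Proof.
move=> a_h; have [j_eq _ _] := hbin_entry a_h.
have [h_mem h_full] := harmonic_inv_run delta c' c P (enum 'I_n) j.
have : HBin j i \in unzip2 h by exact: (map_f snd a_h).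
rewrite h_mem => i_lt exc; apply: h_full.
have i_neq : i != (nopened h j).-1.
  apply: contraNneq exc => ->; rewrite in_cons; apply/orP; right.
  apply/mapP; exists j => //.
  rewrite mem_iota j_eq; have := hclassP (c a).
  by case: hclass => [|[|[|[|[|]]]]].
by move: i_lt i_neq; lia.
Qed.

Lemma rbin_regular a i :
  (a, RBin i) \in h -> RBin i \notin exceptional_bins -> (i.+1 < k)%N.
Proof.
case/run_entry=> h' b_eq; have := pack_itemP P I1p_gt_third h' a.
rewrite -b_eq => i_k; rewrite inE eq_RBin negb_or => /andP[+ _].
by move: i_k; lia.
Qed.

Lemma gbin_index a i : (a, GBin i) \in h -> (i < size (gsets P))%N.
Proof.
case/run_entry=> h' b_eq; have := pack_itemP P I1p_gt_third h' a.
rewrite -b_eq /planned_bin; case: ifP => [+ [<-//]|_].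
by case: ifP.
Qed.

Lemma newbin_item a a' : (a, NewBin a') \in h -> a' = a /\ 1 / 2 < c a.
Proof.
case/run_entry=> h' b_eq; have := pack_itemP P I1p_gt_third h' a.
by rewrite -b_eq => -[].
Qed.

Lemma regular_bin_vol b :
  unguaranteed != set0 -> (forall a a', (a, NewBin a') \notin h) ->
  b \in unzip2 h -> b \notin exceptional_bins ->
  1 <= \sum_(a <- content h b) (3 / 2 * c a).
Proof.
move=> left no_new /mapP[[a b1] ab ->] /=; rewrite -mulr_sumr => {b} reg.
suff : 2 / 3 <= \sum_(a0 <- content h b1) c a0 by lra.
case: b1 ab reg => [i|i|a'|j i] ab reg.
- exact: gbin_vol a _ left (gbin_index ab).
- exact/rbin_vol/(rbin_regular ab reg).
- by have := no_new a a'; rewrite ab.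
have full := hbin_regular ab reg; have [j_eq p_le p_none] := hbin_entry ab.
have class_ge (r : R) : 0 <= r -> (j <= 3)%N ->
    (forall x : R, hclass x = j -> r <= x) ->
    j%:R * r <= \sum_(a0 <- content h (HBin j i)) c a0.
  move=> r_ge0 j_le3 r_le; apply: hbin_class_ge => // x; exact: r_le.
have := hclassP (c a); rewrite -j_eq.
case: j ab reg {j_eq} full class_ge => [|[|[|[|[|j]]]]] ab _ full class_ge //.
(* No class 1 bin arises: an item above 1/2 is in [I1p], and then avoids Harmonic, or in [I1g], and
   then is planned. *)
- case=> a_gt _; have [/p_le|a_p] := boolP (a \in I1p); first lra.
  by have [] := planned_none (p_none a_p); rewrite large_item.
- move=> _.
  have third (x : R) : hclass x = 2 -> 1 / 3 <= x.
    by have := hclassP x => + x2; rewrite x2 => -[/ltW].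
  by apply: le_trans (class_ge _ _ isT third); lra.
- move=> _.
  have fourth (x : R) : hclass x = 3 -> 1 / 4 <= x.
    by have := hclassP x => + x3; rewrite x3 => -[/ltW].
  by apply: le_trans (class_ge _ _ isT fourth); lra.
- by move=> _; move: full; rewrite /harmonic_full /=; lra.
Qed.

Lemma regular_bin_class b :
  unplanned = set0 ->
  (forall x i, (x, RBin i) \in h -> x \in I1p -> 1 / 2 < c x) ->
  b \in unzip2 h -> b \notin exceptional_bins ->
  1 <= \sum_(a <- content h b) class_weight (c a).
Proof.
move=> all_planned no_medium /mapP[[a b1] ab ->] /= {b} reg.
have large x : 1 / 2 < c x -> (x, b1) \in h ->
    1 <= \sum_(a <- content h b1) class_weight (c a).
  move=> x_gt xb; apply: le_trans (sum_content_ge (B := [set x]) _ run_uniq _).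
  - by rewrite big_set1 /class_weight x_gt.
  - by move=> y; exact: class_weight_ge0.
  - by move=> y; rewrite inE => /eqP->.
case: b1 ab reg large => [i|i|a'|j i] ab reg large.
- have i_s := gbin_index ab.
  have x1 : (nth (a, set0) (gsets P) i).1 \in I1g.
    by rewrite -mem_gsets map_f ?mem_nth.
  apply: large (I1g_gt x1) (run_planned (I1g_notin_I1p x1) _).
  apply: (planned_g (a0 := a) i_s).
  by rewrite eqxx.
- have [x xI x_h] := rbin_item (rbin_regular ab reg).
  exact: large (no_medium _ _ x_h xI) x_h.
- by have [_ a_gt] := newbin_item ab; exact: large ab.
have full := hbin_regular ab reg; have [j_eq p_le p_none] := hbin_entry ab.
have class_ge (r : R) : 0 <= r -> (j <= 3)%N ->
    (forall x : R, hclass x = j -> r <= class_weight x) ->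
    j%:R * r <= \sum_(a0 <- content h (HBin j i)) class_weight (c a0).
  move=> r_ge0 j_le3 r_le; apply: hbin_class_ge => // x; exact: r_le.
have := hclassP (c a); rewrite -j_eq.
case: j ab reg {j_eq} full class_ge large
  => [|[|[|[|[|j]]]]] ab _ full class_ge large //.
- by case=> a_gt _; exact: large ab.
- move=> _.
  have half (x : R) : hclass x = 2 -> 1 / 2 <= class_weight x.
    by have := hclassP x => + x2; rewrite x2 => -[_ ->].
  by apply: le_trans (class_ge _ _ isT half); lra.
- move=> _.
  have third (x : R) : hclass x = 3 -> 1 / 3 <= class_weight x.
    by have := hclassP x => + x3; rewrite x3 => -[_ ->].
  by apply: le_trans (class_ge _ _ isT third); lra.
- move=> a_le; have a4 := small_item a_le.
  have [_ a_g a_r] := planned_none (p_none (I4p_notin_I1p a4)).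
  have : a \in unplanned by rewrite !in_setD a_r a_g a4.
  by rewrite all_planned inE.
Qed.

Lemma ph_size :
  (size (undup (unzip2 h)))%:R <= \sum_a (3 / 2 * c a) + 5 \/
  (size (undup (unzip2 h)))%:R <= \sum_a class_weight (c a) + 5.
Proof.
have size_le (w : 'I_n -> R) : (forall a, 0 <= w a) ->
    (forall b, b \in unzip2 h -> b \notin exceptional_bins ->
       1 <= \sum_(a <- content h b) w a) ->
    (size (undup (unzip2 h)))%:R <= \sum_a w a + 5.
  move=> w_ge0 w_full; apply: le_trans (size_bins_le w_ge0 w_full) _.
  by rewrite unzip1_run big_enum.
have vol : unguaranteed != set0 -> (forall a a', (a, NewBin a') \notin h) ->
    (size (undup (unzip2 h)))%:R <= \sum_a (3 / 2 * c a) + 5.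
  move=> left no_new; apply: size_le => [a|b]; last exact: regular_bin_vol.
  by apply: mulr_ge0; [lra|apply/ltW/size_gt0].
have [l [[[_ _ l_m] _ new med] _]] := reserved_setup.
case: (P_valid) => _ _ rs; have [k_le k_eq] := rplan_size rs.
(* If an item of I_4+ is left over, then [k = #|I1p|], while a [NewBin] would need [k < #|I1p|]. *)
have [all_planned|left] := eqVneq unplanned set0; last first.
  left; apply: vol => [|a a'].
    by apply: contraNneq left; rewrite /gplanned => ->; rewrite set0D.
  by apply/negP => /new[_]; rewrite -k_eq ?ltnn.
have [|] := boolP [exists x in I1p, has (fun e =>
    (e.1 == x) && (if e.2 is RBin _ then c x <= 1 / 2 else false)) h].
  case/exists_inP => x xI /hasP[[x1 b] xb /=] /andP[/eqP x_eq].
  case: b xb => // i xb x_le; rewrite x_eq in xb.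
  (* Here [l < k], while a [NewBin] needs [l = k]. Moreover [k > 0], so some item was left when the
     first reserved bin was created. *)
  have l_k := med _ _ xb xI x_le; left; apply: vol => [|a a'].
    by apply: (rplan_nil rs); lia.
  by apply/negP => /new[l_eq _]; lia.
move=> /exists_inPn no_medium; right.
apply: size_le => [a|b]; first exact: class_weight_ge0.
apply: regular_bin_class => // x i xb xI; rewrite ltNge.
apply: contra (no_medium _ xI) => x_le; apply/hasP; exists (x, RBin i) => //=.
by rewrite eqxx.
Qed.

End Analysis.

Theorem theorem3 (R : realType) (delta : R) (delta_gt0 : 0 < delta)
    (delta_le : delta <= 1 / 35) (pl : planner R)
    (pl_valid : valid_planner delta pl) :
  competitive delta (3 / 2) (PH delta pl).
Proof.
exists 5 => L [est_valid act_valid].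
have est_gt0 a : 0 < est L a by case/andP: (est_valid a).
have act_ge a : (1 - delta) * est L a <= act L a.
  by rewrite mulrC; case/andP: (act_valid a).
have act_le a : act L a <= (1 + delta) * est L a /\ act L a <= 1.
  by case/andP: (act_valid a) => _; rewrite le_min mulrC => /andP.
have act_gt0 := size_gt0 delta_le est_gt0 act_ge.
have := ph_size delta_gt0 delta_le est_gt0 act_ge (fun a => (act_le a).1)
  (pl_valid _ _ est_valid).
rewrite -/(PH delta pl L); case=> /le_trans; apply; rewrite lerD2r.
  apply: sum_le_OPT => [a|B B_le1]; first exact: (act_le a).2.
  by rewrite -mulr_sumr; lra.
apply: sum_le_OPT => [a|B B_le1]; first exact: (act_le a).2.
by apply: class_weight_bin => // a; exact/ltW/act_gt0.
Qed.
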